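(* Fix real numbers $R>2$ and $\alpha\in(1,R)$. For each integer $K\ge 1$ let $\mathscr{T}_{K,R}$ be the (finite) set of planted binary plane trees of Horton-Strahler order $K$ whose Horton-Strahler numbers satisfy $N_k\in\left(R^{K-k}-\alpha^{K-k},\,R^{K-k}+\alpha^{K-k}\right)$ for all $k=1,\dots,K$, equipped with the uniform distribution, and let $T_{K,R}$ be a uniformly random element, with Shannon entropy $H(T_{K,R})=\log_2|\mathscr{T}_{K,R}|$. Let $N$ denote the number of vertices of a tree in $\mathscr{T}_{K,R}$ (so $N\to\infty$ as $K\to\infty$). Then the entropy rate $$\mathscr{H}_\infty(R)=\lim_{N\to\infty}\frac{H(T_{K,R})}{N}$$ exists and equals $$\mathscr{H}_\infty(R)=1-\frac{1-H(2/R)}{2-2/R},$$ where $H(z)=-z\log_2 z-(1-z)\log_2(1-z)$ is the binary entropy function.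
   Context: A planted binary plane tree is a finite unlabeled rooted tree whose root has degree one and every other vertex is either a leaf or an internal vertex of degree three, with a specified left/right ordering of children (plane embedding); with $n$ leaves it has $N=2n$ vertices. Horton-Strahler ordering: each leaf has order $1$; an internal vertex whose two children have orders $i$ and $j$ has order $\max(i,j)+\delta_{ij}$ (Kronecker delta); the parental edge of a vertex (the edge to its parent, toward the root) has the order of the vertex; a branch of order $i$ is a maximal sequence of neighboring vertices of order $i$ together with their parental edges. The order $K$ of the tree is the maximal vertex order, and the Horton-Strahler numbers are $N_i$ = number of branches of order $i$, $i=1,\dots,K$ (so $N_K=1$, $N_i\ge 2N_{i+1}$, and $N=2N_1$). *)

(* Defs.v *)
From HB Require Import structures.
From mathcomp Require Import all_boot all_order all_algebra finmap.
From mathcomp Require Import all_classical all_reals all_analysis.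
Set Implicit Arguments.
Unset Strict Implicit.
Unset Printing Implicit Defensive.
Import Order.TTheory GRing.Theory Num.Theory.
Import numFieldNormedType.Exports.
Local Open Scope classical_set_scope.
Local Open Scope ring_scope.

(* A planted binary plane tree is represented by what hangs below its root: the
   degree-one root itself is left implicit, and [Node l r] is a vertex of degree
   three with left child [l], right child [r] and an edge towards the root. *)
Inductive bintree : Type := Leaf | Node of bintree & bintree.

Fixpoint bintree_encode (t : bintree) : GenTree.tree unit :=
  match t with
  | Leaf => GenTree.Leaf tt
  | Node l r => GenTree.Node 0 [:: bintree_encode l; bintree_encode r]
  end.

Fixpoint bintree_decode (u : GenTree.tree unit) : option bintree :=
  match u with
  | GenTree.Leaf _ => Some Leaf
  | GenTree.Node _ [:: a; b] =>
      match bintree_decode a, bintree_decode b with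
      | Some l, Some r => Some (Node l r)
      | _, _ => None
      end
  | _ => None
  end.

Lemma bintree_encodeK : pcancel bintree_encode bintree_decode.
Proof. by elim=> //= l -> r ->. Qed.

HB.instance Definition _ := Countable.copy bintree (pcan_type bintree_encodeK).

(* Vertices other than the root are named by the path of left ([false]) and
   right ([true]) turns leading to them. *)
Definition vertex := seq bool.

Fixpoint vertices (t : bintree) : seq vertex :=
  match t with
  | Leaf => [:: [::]]
  | Node l r => [::] :: [seq false :: v | v <- vertices l]
                     ++ [seq true :: v | v <- vertices r]
  end.

(* The successor accounts for the root. *)
Definition num_vertices (t : bintree) : nat := (size (vertices t)).+1.

Definition is_child (v w : vertex) : bool :=
  (w == rcons v false) || (w == rcons v true).

Fixpoint subtree (t : bintree) (v : vertex) : bintree :=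
  match v, t with
  | b :: v', Node l r => subtree (if b then r else l) v'
  | _, _ => t
  end.

(* Horton-Strahler order of the topmost non-root vertex. *)
Fixpoint top_order (t : bintree) : nat :=
  match t with
  | Leaf => 1
  | Node l r => maxn (top_order l) (top_order r)
                + (top_order l == top_order r)
  end%N.

Definition vertex_order (t : bintree) (v : vertex) : nat :=
  top_order (subtree t v).

Definition tree_order (t : bintree) : nat :=
  (\max_(v <- vertices t) vertex_order t v)%N.

(* Sequences of neighboring vertices of order [i], listed downwards. *)
Definition order_chain (t : bintree) (i : nat) (s : seq vertex) : bool :=
  [&& s != [::],
      all (fun v => (v \in vertices t) && (vertex_order t v == i)) s
    & sorted is_child s].

(* Parental edges are determined by the vertices, hence not recorded. *)
Definition is_branch (t : bintree) (i : nat) (s : seq vertex) : Prop :=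
  order_chain t i s /\
  forall s', order_chain t i s' -> infix s s' -> s' = s.

Definition num_branches (t : bintree) (i : nat) : nat :=
  #|` fset_set [set s | is_branch t i s]|.

(* [fset_set] is a default value on infinite sets; this rules that case out. *)
Lemma finite_branches (t : bintree) (i : nat) :
  finite_set [set s | is_branch t i s].
Proof.
have fin (n : nat) : finite_set
    [set s : seq vertex | (size s <= n)%N /\ all (mem (vertices t)) s].
  elim: n => [|n IHn].
    apply: (@sub_finite_set _ _ [set [::]]); last exact: finite_set1.
    by move=> s /= [+ _]; rewrite leqn0 => /nilP.
  apply: (@sub_finite_set _ _ ([set [::]] `|`
    [set v :: s | v in [set` vertices t] & s in
      [set s : seq vertex | (size s <= n)%N /\ all (mem (vertices t)) s]])).
    move=> [|v s] /= [sz]; first by left.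
    by move=> /andP[vt st]; right; exists v => //; exists s.
  rewrite finite_setU; split; first exact: finite_set1.
  by apply: finite_image2 => //; exact: finite_seq.
apply: (sub_finite_set _ (fin (size (vertices t)))) => s [/and3P[_ als ss] _].
have st : all (mem (vertices t)) s.
  by apply: sub_all als => v /andP[].
split=> //; apply: uniq_leq_size; last exact/allP.
apply: (@sorted_uniq _ (fun v w : vertex => (size v < size w)%N)).
- by move=> v u w; exact: ltn_trans.
- by move=> v; exact: ltnn.
- apply: sub_sorted ss => v w; rewrite /is_child.
  by case/orP => /eqP ->; rewrite size_rcons.
Qed.

Definition hs_trees (R : realType) (r alpha : R) (K : nat) : set bintree :=
  [set t | tree_order t = K /\
    forall k : nat, (1 <= k <= K)%N ->
      r ^+ (K - k) - alpha ^+ (K - k) < (num_branches t k)%:R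
        < r ^+ (K - k) + alpha ^+ (K - k)].

Definition log2 (R : realType) (x : R) : R := ln x / ln 2.

Definition uniform_mass (R : realType) (T : choiceType) (A : {fset T}) (x : T) :
    R :=
  if x \in A then (#|` A|%:R)^-1 else 0.

Definition shannon_entropy (R : realType) (T : choiceType) (A : {fset T})
    (p : T -> R) : R :=
  - \sum_(x <- A) p x * log2 (p x).

Lemma shannon_entropy_uniform (R : realType) (T : choiceType) (A : {fset T}) :
  A != fset0 -> shannon_entropy A (uniform_mass R A) = log2 #|` A|%:R.
Proof.
move=> A0; have cA : (0 < #|` A|)%N by rewrite cardfs_gt0.
rewrite /shannon_entropy big_seq.
under eq_bigr => x xA do rewrite /uniform_mass xA.
rewrite -big_seq big_const_seq count_predT iter_addr_0 -[X in - X]mulr_natl.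
rewrite mulrA divff ?pnatr_eq0 -?lt0n// mul1r.
by rewrite /log2 lnV ?posrE ?ltr0n// mulNr opprK.
Qed.

Definition hs_entropy (R : realType) (r alpha : R) (K : nat) : R :=
  let A := fset_set (hs_trees r alpha K) in
  shannon_entropy A (uniform_mass R A).

Definition binary_entropy (R : realType) (z : R) : R :=
  - (z * log2 z) - (1 - z) * log2 (1 - z).

(* Main.v *)
(** Let [p = 2 / r] and [q = (1 - p) / 2], so that [p + 2 q = 1].

    Upper bound: give a tree the weight [q ^ N_1 * (p ^ 2 / q) ^ (N_2 + ... + N_K)].
    Splitting a tree at its top vertex shows, by induction, that the trees of
    order [k] have total weight at most [p ^ (k - 1) * q].  The logarithm of the
    weight is linear in the Horton numbers, so on the trees under consideration
    it is constant up to [O(K alpha ^ K)], which bounds their number.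

    Lower bound: Horton pruning forgets a word that records, along the edges of
    the pruned tree, the removed leaves.  Hence for prescribed Horton numbers
    there are at least
    [prod_k 'C(N_k - 2, 2 N_(k+1) - 2) * 2 ^ (N_k - 2 N_(k+1))] trees, and with
    [N_k] the integer part of [r ^ (K - k)] Stirling's formula shows that the
    logarithm of this number has the same main term, up to [O(K ^ 2)]. *)

Require Import Defs.
From mathcomp Require Import all_boot all_order all_algebra finmap.
From mathcomp Require Import all_classical all_reals all_analysis.
From mathcomp Require Import zify ring lra.
Import Order.TTheory GRing.Theory Num.Theory.
Import numFieldNormedType.Exports.
Local Open Scope classical_set_scope.
Local Open Scope ring_scope.

(** * Horton numbers: from maximal chains to a recursion on the tree *)

Section HortonNumbers.
Local Open Scope nat_scope.

(** Recursive form of the Horton numbers: a branch begins at a leaf or where two children of equal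
    order meet; any other internal vertex prolongs a branch from below. *)
Fixpoint branch_count (t : bintree) (i : nat) : nat :=
  match t with
  | Leaf => i == 1
  | Node l r => branch_count l i + branch_count r i
                + ((top_order l == top_order r) && (i == (top_order l).+1))
  end.

Lemma branch_count_node l r i : branch_count (Node l r) i =
  branch_count l i + branch_count r i
  + ((top_order l == top_order r) && (i == (top_order l).+1)).
Proof. by []. Qed.

Lemma top_order_gt0 t : 0 < top_order t.
Proof. by elim: t => //= l hl r hr; lia. Qed.

Lemma branch_count_leaf_gt0 t : 0 < branch_count t 1.
Proof. by elim: t => //= l hl r hr; lia. Qed.

Lemma branch_count_node1 l r :
  branch_count (Node l r) 1 = branch_count l 1 + branch_count r 1.
Proof. by move: (top_order_gt0 l) => /=; lia. Qed.

Lemma top_order_node l r : top_order (Node l r) =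
  maxn (top_order l) (top_order r) + (top_order l == top_order r).
Proof. by []. Qed.

Lemma num_verticesE t : num_vertices t = (branch_count t 1).*2.
Proof.
rewrite /num_vertices; suff : size (vertices t) = (branch_count t 1).*2.-1.
  by move: (branch_count_leaf_gt0 t); lia.
elim: t => // l hl r hr; rewrite branch_count_node1 /= size_cat !size_map hl hr.
by move: (branch_count_leaf_gt0 l) (branch_count_leaf_gt0 r); lia.
Qed.

Lemma root_vertices t : [::] \in vertices t.
Proof. by case: t. Qed.

Lemma vertices_uniq t : uniq (vertices t).
Proof.
elim: t => //= l hl r hr; rewrite mem_cat cat_uniq !map_inj_uniq ?hl ?hr //=;
  try by move=> ? ? [].
rewrite andbT; apply/andP; split.
  by apply/norP; split; apply/negP => /mapP [].
by apply/hasPn => x /mapP [y _ ->]; apply/negP => /mapP [].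
Qed.

Lemma mem_verticesF l r v : (false :: v \in vertices (Node l r)) = (v \in vertices l).
Proof.
rewrite /= inE /= mem_cat mem_map; last by move=> ? ? [].
by case: (_ \in map (cons true) _) / mapP => [[]|]//; rewrite orbF.
Qed.

Lemma mem_verticesT l r v : (true :: v \in vertices (Node l r)) = (v \in vertices r).
Proof.
rewrite /= inE /= mem_cat (mem_map (f := cons true)); last by move=> ? ? [].
by case: (_ \in map (cons false) _) / mapP => [[]|].
Qed.

Lemma mem_vertices_rcons t v b : rcons v b \in vertices t -> v \in vertices t.
Proof.
elim: t v => [|l hl r hr] [|[] v] //; rewrite rcons_cons.
- by rewrite !mem_verticesT => /hr.
- by rewrite !mem_verticesF => /hl.
Qed.

Lemma subtree_nil t : subtree t [::] = t.
Proof. by case: t. Qed.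

Lemma vertex_order_le t v : vertex_order t v <= top_order t.
Proof.
rewrite /vertex_order; elim: t v => [|l hl r hr] [|b v] //.
rewrite [subtree _ _]/= top_order_node.
by case: b; [move: (hr v)|move: (hl v)]; lia.
Qed.

Lemma tree_orderE t : tree_order t = top_order t.
Proof.
apply/eqP; rewrite eqn_leq; apply/andP; split.
  by apply/bigmax_leqP_seq => v _ _; exact: vertex_order_le.
have -> : top_order t = vertex_order t [::] by rewrite /vertex_order subtree_nil.
by apply: leq_bigmax_seq => //; exact: root_vertices.
Qed.

Lemma subtree_rcons t v b : rcons v b \in vertices t ->
  exists l r, subtree t v = Node l r /\
    subtree t (rcons v b) = if b then r else l.
Proof.
elim: t v => [|l hl r hr] v; first by case: v.
case: v => [|c v].
- by move=> _; exists l, r; case: (b); [case: (r)|case: (l)].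
- rewrite rcons_cons; case: c; [rewrite mem_verticesT => /hr|rewrite mem_verticesF => /hl];
  by move=> [l' [r' H]]; exists l', r'.
Qed.

(* Two children of order [i] would give their parent order [i.+1]. *)
Lemma order_child_unique t i v a b :
  rcons v a \in vertices t -> rcons v b \in vertices t ->
  vertex_order t v = i -> vertex_order t (rcons v a) = i ->
  vertex_order t (rcons v b) = i -> a = b.
Proof.
rewrite /vertex_order => /subtree_rcons [l [r [E1 E2]]] /subtree_rcons [l' [r' [E3 E4]]].
rewrite E2 E4 E1 top_order_node; move: E3; rewrite E1 => -[<- <-].
by case: a b E2 E4 => -[] //= _ _; lia.
Qed.

Definition parent (v : vertex) : vertex := take (size v).-1 v.

Lemma parent_rcons v b : parent (rcons v b) = v.
Proof. by rewrite /parent size_rcons /= -cats1 take_size_cat. Qed.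

Lemma parent_cons b c v : parent (b :: c :: v) = b :: parent (c :: v).
Proof. by []. Qed.

Lemma is_child_parent v w : is_child v w -> w != [::] /\ parent w = v.
Proof. by case/orP => /eqP ->; rewrite parent_rcons; case: v. Qed.

(** The parent of the topmost vertex lies outside [t]; the flag [b] tells whether its order is taken
    to differ from [i]. *)
Definition is_top (t : bintree) (i : nat) (b : bool) (v : vertex) : bool :=
  (vertex_order t v == i) && (if v is [::] then b else vertex_order t (parent v) != i).

(** With [b] false the topmost vertex continues a branch from above, and the extra term restores the
    branch then missed. The induction needs both values of [b], since a subtree sees its parent only
    through this flag. *)
Lemma count_top t i b :
  count (is_top t i b) (vertices t) + (~~ b && (top_order t == i)) = branch_count t i.
Proof.
elim: t b => [|l hl r hr] b.
  by rewrite /= /is_top /vertex_order /= eq_sym; case: b; case: (i == 1).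
set T := top_order (Node l r).
have cnt (c : bool) (s : seq vertex) (u := if c then r else l) :
    count (is_top (Node l r) i b) [seq c :: v | v <- s] = count (is_top u i (T != i)) s.
  rewrite count_map; apply: eq_count => -[|d v] /=.
    by rewrite /is_top /vertex_order {}/u; case: c; rewrite /= subtree_nil.
  by rewrite /is_top parent_cons /vertex_order {}/u /=; case: c.
rewrite [vertices _]/= [count _ _]/= count_cat !cnt branch_count_node.
move: (hl (T != i)) (hr (T != i)) => {hl hr} <- <-.
rewrite {1}/is_top [vertex_order _ [::]]/vertex_order [subtree _ _]/= -/T.
rewrite /T top_order_node.
move: (count _ (vertices l)) (count _ (vertices r)) => x y.
move: (top_order l) (top_order r) => a c.
by clear cnt; case: b => /=; lia.
Qed.

Lemma order_chain1 t i v : v \in vertices t -> vertex_order t v = i ->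
  order_chain t i [:: v].
Proof. by move=> h1 h2; rewrite /order_chain /= h1 h2 eqxx. Qed.

Lemma order_chain_size t i s : order_chain t i s -> size s <= size (vertices t).
Proof.
case/and3P => _ als ss; apply: uniq_leq_size; last first.
  by move=> v /(allP als) /andP[].
apply: (@sorted_uniq _ (fun v w : vertex => size v < size w)).
- by move=> v u w; exact: ltn_trans.
- by move=> v; exact: ltnn.
- by apply: sub_sorted ss => v w /orP[] /eqP ->; rewrite size_rcons.
Qed.

(** A chain that is not maximal has a strictly longer extension, and the number of vertices bounds
    the length, so extending stops at a branch. *)
Lemma order_chain_extend t i s : order_chain t i s ->
  exists s', is_branch t i s' /\ infix s s'.
Proof.
have [n] := ubnP (size (vertices t) - size s); elim: n s => // n IH s hn hs.
have [max|] := pselect (forall s', order_chain t i s' -> infix s s' -> s' = s).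
  by exists s; split=> //; exact: infix_refl.
move=> /existsNP [s' /not_implyP [hs' /not_implyP [hi hne]]].
have lt : size s < size s'.
  rewrite ltn_neqAle size_infix // andbT; apply/eqP => e; apply: hne.
  move: hi e => /infixP [a [b ->]] /eqP; rewrite !size_cat addnCA.
  rewrite -{1}[size s]addn0 eqn_add2l eq_sym addn_eq0 => /andP[/nilP -> /nilP ->].
  by rewrite cats0.
have [|u [hu iu]] := IH s' _ hs'.
  by move: (order_chain_size _ _ _ hs'); lia.
by exists u; split=> //; exact: infix_trans hi iu.
Qed.

(** If the parent of the head also had order [i], prepending it would contradict maximality. *)
Lemma branch_head_top t i s : is_branch t i s ->
  head [::] s \in [seq v <- vertices t | is_top t i true v].
Proof.
case: s => [[]//|v s [hc hm]] /=.
have /and3P [_ /= /andP[/andP[vt /eqP vo] als] ps] := hc.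
rewrite mem_filter vt andbT /is_top vo eqxx /=.
case: (lastP v) vt vo hc hm als ps => // w b vt vo hc hm als ps.
have -> : forall x : bool, (if rcons w b is [::] then true else x) = x by case: (w).
rewrite parent_rcons; apply/negP => /eqP wo.
have := hm (w :: rcons w b :: s); rewrite -cat1s suffix_infix ?suffix_suffix //.
have -> : order_chain t i ([:: w] ++ rcons w b :: s).
  rewrite /order_chain /= (mem_vertices_rcons _ _ _ vt) wo eqxx vt vo eqxx als ps.
  by rewrite /is_child; case: b {vt vo hc hm als ps}; rewrite eqxx ?orbT.
by move=> /(_ isT isT) /(congr1 size) /=; lia.
Qed.

(** By [order_child_unique] a chain has no choice on its way down. *)
Lemma chain_prefix t i v s u :
  order_chain t i (v :: s) -> order_chain t i (v :: u) -> size s <= size u ->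
  prefix s u.
Proof.
elim: s v u => [|a s IH] v [|b u] //=.
move=> /and3P [_ /= /and3P[/andP[_ /eqP vo] /andP[aV /eqP ao] als] /andP[ca ps]].
move=> /and3P [_ /= /and3P[_ /andP[bV /eqP bo] alu] /andP[cb pu]] sz.
have E : a = b.
  move: ca cb aV ao bV bo {als alu ps pu}.
  by case/orP => /eqP -> /orP [] /eqP -> aV ao bV bo //;
    have := order_child_unique _ _ _ _ _ aV bV vo ao bo.
rewrite E eqxx /=; apply: (IH b) => //.
  by rewrite /order_chain /= -E aV ao eqxx als ps.
by rewrite /order_chain /= bV bo eqxx alu pu.
Qed.

Lemma branch_head_inj t i s u : is_branch t i s -> is_branch t i u ->
  head [::] s = head [::] u -> s = u.
Proof.
wlog le : s u / size s <= size u.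
  move=> H hs hu e; case: (leqP (size s) (size u)) => h; first exact: H.
  by apply/esym; apply: H => //; exact: ltnW.
case: s le => [_ [[]]//|v s]; case: u => [_ _ [[]]//|w u] le [hs ms] [hu mu] /= e.
apply/esym/ms => //; rewrite -e.
have := chain_prefix _ _ _ _ _ hs; rewrite -e in hu => /(_ _ hu le) pre.
by apply: prefixW; rewrite /= eqxx.
Qed.

(** The chain [[:: v]] extends to a branch. Whatever preceded [v] there would be its parent, which
    does not have order [i]. *)
Lemma top_branch t i v : v \in [seq v <- vertices t | is_top t i true v] ->
  exists2 s, is_branch t i s & head [::] s = v.
Proof.
rewrite mem_filter => /andP[/andP[/eqP vo pv] vt].
have [s [bs /infixP [a [b E]]]] := order_chain_extend _ _ _ (order_chain1 _ _ _ vt vo).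
exists s => //; rewrite E; case: (lastP a) E => // a' w E.
have /and3P [_ als ss] := bs.1; exfalso.
move: als ss; rewrite E cat_rcons /= all_cat => /andP[_ /= /andP[/andP[_ /eqP wo] _]].
case: a' {E} => [|z a'] /=; rewrite ?cat_path /= => /andP[].
  move=> /is_child_parent [v0 pw]; move: pv v0.
  by case: v pw {vo vt} => //= ? ? ->; rewrite wo eqxx.
move=> _ /andP[_ /andP[+ _]].
move=> /is_child_parent [v0 pw]; move: pv v0.
by case: v pw {vo vt} => //= ? ? ->; rewrite wo eqxx.
Qed.

(** Taking heads is a bijection from branches to the vertices counted by [count_top]. *)
Lemma num_branchesE t i : num_branches t i = branch_count t i.
Proof.
have := count_top t i true; rewrite addn0 => <-; rewrite -size_filter.
set tops := [seq x <- _ | _].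
have inA s : (s \in fset_set [set s | is_branch t i s]) = `[< is_branch t i s >].
  by rewrite in_fset_set; [rewrite unfold_in|exact: finite_branches].
have <- : #|` [fset x in tops]%fset| = size tops.
  by rewrite card_fseq undup_id // filter_uniq // vertices_uniq.
have <- : [fset head [::] s | s in fset_set [set s | is_branch t i s]]%fset
   = [fset x in tops]%fset.
  apply/fsetP => v; rewrite !inE; apply/imfsetP/idP => /=.
    by case=> s; rewrite inA => /asboolP bs ->; exact: branch_head_top.
  by case/top_branch => s bs <-; exists s => //; rewrite inA; apply/asboolP.
rewrite card_in_imfset //= => s u; rewrite !inA => /asboolP bs /asboolP bu.
exact: branch_head_inj bs bu.
Qed.

End HortonNumbers.

(** * Horton pruning, its inverse, and trees with prescribed Horton numbers *)

Section Pruning.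
Local Open Scope nat_scope.

(* Horton pruning: leaves are removed and the vertices left with one child are
   contracted; it shifts the Horton numbers by one. *)
Fixpoint prune (t : bintree) : bintree :=
  match t with
  | Leaf | Node Leaf Leaf => Leaf
  | Node Leaf r => prune r
  | Node l Leaf => prune l
  | Node l r => Node (prune l) (prune r)
  end.

(* Records in preorder what pruning forgets: [Some b] is a leaf removed on the
   left ([b = false]) or right of an edge of the pruned tree, [None] is the end of
   such an edge. *)
Fixpoint pruned_word (t : bintree) : seq (option bool) :=
  match t with
  | Leaf => [::]
  | Node Leaf Leaf => [:: None]
  | Node Leaf r => Some false :: pruned_word r
  | Node l Leaf => Some true :: pruned_word l
  | Node l r => None :: pruned_word l ++ pruned_word r
  end.

Definition edge_ends (w : seq (option bool)) : nat := count (predC isSome) w.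

Definition side_leaves (w : seq (option bool)) : nat := count isSome w.

Lemma edge_ends_cat w x : edge_ends (w ++ x) = edge_ends w + edge_ends x.
Proof. exact: count_cat. Qed.

Lemma side_leaves_cat w x : side_leaves (w ++ x) = side_leaves w + side_leaves x.
Proof. exact: count_cat. Qed.

Lemma edge_ends_side_leaves w : edge_ends w + side_leaves w = size w.
Proof. by rewrite addnC; exact: count_predC. Qed.

Definition nonleaf (t : bintree) : bool := if t is Leaf then false else true.

Lemma prune_ind (P : bintree -> Prop) :
  P (Node Leaf Leaf) ->
  (forall t, nonleaf t -> P t -> P (Node Leaf t)) ->
  (forall t, nonleaf t -> P t -> P (Node t Leaf)) ->
  (forall l r, nonleaf l -> nonleaf r -> P l -> P r -> P (Node l r)) ->
  forall t, nonleaf t -> P t.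
Proof.
move=> P0 Pl Pr Pn; elim=> // l IHl r IHr _.
case: l IHl => [|l1 l2] IHl; case: r IHr => [|r1 r2] IHr //.
- by apply: Pl => //; exact: IHr.
- by apply: Pr => //; exact: IHl.
- by apply: Pn => //; [exact: IHl|exact: IHr].
Qed.

Lemma prune_nodeLt t : nonleaf t -> prune (Node Leaf t) = prune t.
Proof. by case: t. Qed.

Lemma prune_nodetL t : nonleaf t -> prune (Node t Leaf) = prune t.
Proof. by case: t. Qed.

Lemma prune_node l r : nonleaf l -> nonleaf r ->
  prune (Node l r) = Node (prune l) (prune r).
Proof. by case: l => //; case: r. Qed.

Lemma pruned_word_nodeLt t : nonleaf t ->
  pruned_word (Node Leaf t) = Some false :: pruned_word t.
Proof. by case: t. Qed.

Lemma pruned_word_nodetL t : nonleaf t ->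
  pruned_word (Node t Leaf) = Some true :: pruned_word t.
Proof. by case: t. Qed.

Lemma pruned_word_node l r : nonleaf l -> nonleaf r ->
  pruned_word (Node l r) = None :: pruned_word l ++ pruned_word r.
Proof. by case: l => //; case: r. Qed.

(** A removed side leaf has smaller order than its sibling, so contracting its parent changes no
    order. *)
Lemma top_order_prune t : nonleaf t -> top_order t = (top_order (prune t)).+1.
Proof.
elim/prune_ind => {t} // [t nt IH|t nt IH|l r nl nr IHl IHr].
- rewrite prune_nodeLt // top_order_node IH /=.
  by have := top_order_gt0 (prune t); lia.
- rewrite prune_nodetL // top_order_node IH /=.
  by have := top_order_gt0 (prune t); lia.
- by rewrite prune_node // !top_order_node IHl IHr; lia.
Qed.

Lemma branch_count_prune t i : nonleaf t ->
  branch_count t i.+2 = branch_count (prune t) i.+1.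
Proof.
elim/prune_ind => {t} // [t nt IH|t nt IH|l r nl nr IHl IHr].
- rewrite prune_nodeLt // branch_count_node IH (top_order_prune t) //=.
  by have := top_order_gt0 (prune t); lia.
- rewrite prune_nodetL // branch_count_node IH (top_order_prune t) //=.
  by have := top_order_gt0 (prune t); lia.
- rewrite prune_node // !branch_count_node IHl IHr.
  by rewrite (top_order_prune l) // (top_order_prune r) //; lia.
Qed.

(** Leaves of [t] come either in sibling pairs, one for each leaf of the pruned tree, or singly as
    side leaves. *)
Lemma branch_count1_prune t : nonleaf t -> branch_count t 1 =
  (branch_count (prune t) 1).*2 + side_leaves (pruned_word t).
Proof.
elim/prune_ind => {t} // [t nt IH|t nt IH|l r nl nr IHl IHr].
- by rewrite prune_nodeLt // pruned_word_nodeLt // branch_count_node1 IH /=; lia.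
- by rewrite prune_nodetL // pruned_word_nodetL // branch_count_node1 IH /=; lia.
- rewrite prune_node // pruned_word_node // !branch_count_node1 IHl IHr -cat1s.
  by rewrite !side_leaves_cat [side_leaves [:: None]]/=; lia.
Qed.

(** Each non-root vertex of the pruned tree ends one edge, and with [n] leaves there are [2n - 1]
    such vertices. *)
Lemma edge_ends_pruned_word t : nonleaf t ->
  (edge_ends (pruned_word t)).+1 = (branch_count (prune t) 1).*2.
Proof.
elim/prune_ind => {t} // [t nt IH|t nt IH|l r nl nr IHl IHr].
- by rewrite prune_nodeLt // pruned_word_nodeLt.
- by rewrite prune_nodetL // pruned_word_nodetL.
- rewrite prune_node // pruned_word_node // branch_count_node1 doubleD -IHl -IHr -cat1s.
  by rewrite !edge_ends_cat /= /edge_ends /=; lia.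
Qed.

(** Decoding in preorder: the unread rest [x] is returned so that, after the left subtree, decoding
    can go on with the right one. *)
Lemma graft_prefix t w : (branch_count t 1).*2 <= (edge_ends w).+1 ->
  exists u x, [/\ nonleaf u, prune u = t & w = pruned_word u ++ x].
Proof.
have some_case t' b v x u : nonleaf u -> prune u = t' -> v = pruned_word u ++ x ->
    exists u' x', [/\ nonleaf u', prune u' = t' & Some b :: v = pruned_word u' ++ x'].
  move=> nu pu ->; exists (if b then Node u Leaf else Node Leaf u), x.
  by case: b; rewrite ?prune_nodeLt ?prune_nodetL ?pruned_word_nodeLt ?pruned_word_nodetL.
elim: t w => [|l IHl r IHr] w.
  elim: w => [//|[b|] w IHw] h.
    by have [u [x [nu pu]]] := IHw h; exact: some_case.
  by exists (Node Leaf Leaf), w.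
have hl := branch_count_leaf_gt0 l; have hr := branch_count_leaf_gt0 r.
elim: w => [|[b|] w IHw]; rewrite branch_count_node1 /=; first by lia.
  rewrite branch_count_node1 in IHw.
  by move=> h; have [u [x [nu pu]]] := IHw h; exact: some_case.
move=> h; have [|u [x [nu pu E]]] := IHl w; first by lia.
have cE : (edge_ends w).+1 = (branch_count l 1).*2 + edge_ends x.
  by rewrite E edge_ends_cat -addSn edge_ends_pruned_word // pu.
have [|v [y [nv pv F]]] := IHr x; first by lia.
exists (Node u v), y; split => //; first by rewrite prune_node // pu pv.
by rewrite pruned_word_node //= -catA -F -E.
Qed.

(** The last letter of a code is always [None], so only [w] is free. Counting edge ends shows that
    decoding leaves no letter unread. *)
Lemma graft_exists t w : (edge_ends w).+2 = (branch_count t 1).*2 ->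
  exists u, [/\ nonleaf u, prune u = t & pruned_word u = rcons w None].
Proof.
move=> h; have [|u [x [nu pu E]]] := graft_prefix t (rcons w None).
  by rewrite -cats1 edge_ends_cat /=; lia.
exists u; split=> //; case: (lastP x) E => [|y o]; first by rewrite cats0.
rewrite -rcons_cat => /rcons_inj [E _]; exfalso.
have := edge_ends_pruned_word u nu; rewrite pu -h E edge_ends_cat; lia.
Qed.

Fixpoint edge_words (n m : nat) : seq (seq (option bool)) :=
  match n with
  | 0 => if m is 0 then [:: [::]] else [::]
  | n'.+1 => map (cons None) (if m is m'.+1 then edge_words n' m' else [::])
             ++ map (cons (Some false)) (edge_words n' m)
             ++ map (cons (Some true)) (edge_words n' m)
  end.

(** Splitting on the first letter is Pascal's rule, with a factor 2 for the side of each leaf. *)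
Lemma size_edge_words n m : size (edge_words n m) = 'C(n, m) * 2 ^ (n - m).
Proof.
elim: n m => [|n IH] [|m] //=; rewrite ?size_cat !size_map !IH.
  by rewrite !bin0 subn0 expnS; lia.
rewrite binS mulnDl subSS addnC addnn; congr (_ + _).
case: (ltnP m n) => h; last by rewrite bin_small.
by rewrite -(subnSK h) expnS; lia.
Qed.

Lemma edge_words_count n m w : w \in edge_words n m ->
  size w = n /\ edge_ends w = m.
Proof.
elim: n m w => [|n IH] m w /=; first by case: m => //; rewrite inE => /eqP ->.
rewrite !mem_cat => /or3P [] /mapP [v hv ->] /=.
- by case: m hv => // m /IH [-> ->].
- by have [-> ->] := IH _ _ hv.
- by have [-> ->] := IH _ _ hv.
Qed.

Lemma edge_words_uniq n m : uniq (edge_words n m).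
Proof.
have ci (o : option bool) : injective (cons o) by move=> ? ? [].
elim: n m => [|n IH] m; first by case: m.
rewrite [edge_words _ _]/= !cat_uniq !(map_inj_uniq (ci _)) !IH /=.
rewrite !andbT; apply/and3P; split.
- by case: m.
- apply/hasPn => x; rewrite mem_cat => /orP[] /mapP [v _ ->];
  by apply/negP => /mapP [].
- by apply/hasPn => x /mapP [v _ ->]; apply/negP => /mapP [].
Qed.

Definition horton_profile (N : nat -> nat) (K : nat) (t : bintree) : Prop :=
  top_order t = K /\ forall k, 1 <= k <= K -> branch_count t k = N (K - k).

(* The product is Shreve's exact count; only the lower bound is needed. *)
Lemma trees_of_profile (N : nat -> nat) (K : nat) :
  N 0 = 1 -> (forall j, (N j).*2 <= N j.+1) ->
  exists s : seq bintree, [/\ uniq s,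
    (forall t, t \in s -> horton_profile N K.+1 t) &
    size s = \prod_(j < K) ('C(N j.+1 - 2, (N j).*2 - 2) * 2 ^ (N j.+1 - (N j).*2))].
Proof.
move=> N0 Nd; have Np j : 0 < N j by elim: j => [|j IH]; [rewrite N0|move: (Nd j); lia].
elim: K => [|K [s [us ps ss]]].
  exists [:: Leaf]; split=> //; last by rewrite big_ord0.
  by move=> t; rewrite inE => /eqP ->; split=> // k hk; have -> : k = 1 by lia.
(* A code over a tree with [N K] leaves has [2 N K - 1] edge ends and needs [N K.+1 - 2 N K] side
   leaves; its forced final [None] is not counted in [n] and [m]. *)
set n := N K.+1 - 2; set m := (N K).*2 - 2.
have [g gP] : exists g : bintree * seq (option bool) -> bintree, forall x,
    (edge_ends x.2).+2 = (branch_count x.1 1).*2 ->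
    [/\ nonleaf (g x), prune (g x) = x.1 & pruned_word (g x) = rcons x.2 None].
  have H x : exists u, (edge_ends x.2).+2 = (branch_count x.1 1).*2 ->
      [/\ nonleaf u, prune u = x.1 & pruned_word u = rcons x.2 None].
    case: x => t w /=.
    have [/graft_exists [u hu]|h] := pselect ((edge_ends w).+2 = (branch_count t 1).*2).
      by exists u.
    by exists Leaf.
  by exists (fun x => sval (cid (H x))) => x; exact: (svalP (cid (H x))).
pose prs := [seq (t, w) | t <- s, w <- edge_words n m].
have prsP x : x \in prs -> [/\ horton_profile N K.+1 x.1, size x.2 = n,
    edge_ends x.2 = m & (edge_ends x.2).+2 = (branch_count x.1 1).*2].
  case/allpairsP => -[t w] /= [ts /edge_words_count [sw cw] ->] /=; split=> //; first exact: ps.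
  by rewrite cw /m; have [_ ->//] := ps _ ts; rewrite subSS subn0; move: (Np K); lia.
exists [seq g x | x <- prs]; split.
- rewrite map_inj_in_uniq.
    by apply: allpairs_uniq => //; [exact: edge_words_uniq|move=> [? ?] [? ?]].
  (* The grafted tree gives back the pair through [prune] and [pruned_word]. *)
  move=> [t w] [t' w'] /prsP [_ _ _ /gP [_ /= p1 w1]] /prsP [_ _ _ /gP [_ /= p2 w2]] E.
  by move: p1 w1; rewrite E p2 w2 => -> /rcons_inj [->].
- move=> u /mapP [x /prsP [[ox nx] szx cx hx] ->]; have [nu pu wu] := gP _ hx.
  split; first by rewrite top_order_prune // pu ox.
  case=> [//|[|k]] hk.
    rewrite branch_count1_prune // pu wu nx // -cats1 side_leaves_cat !subSS !subn0.
    have := edge_ends_side_leaves x.2; rewrite cx szx /n /m [side_leaves [:: None]]/=.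
    by move: (Nd K) (Np K) (side_leaves _) => *; lia.
  by rewrite branch_count_prune // pu nx // !subSS.
- by rewrite size_map size_allpairs ss size_edge_words big_ord_recr /=; congr (_ * (_ * 2 ^ _));
     move: (Nd K) (Np K); rewrite /n /m; lia.
Qed.

End Pruning.

(** * Total weight of the trees of a given order *)

Section WeightedTrees.

(** A finite range for the weight sums: [h] bounds the height, so splitting at the top vertex lowers
    it by one. *)
Fixpoint trees_upto (h : nat) : seq bintree :=
  match h with
  | 0 => [::]
  | h'.+1 => Leaf :: [seq Node l r | l <- trees_upto h', r <- trees_upto h']
  end%N.

Lemma mem_trees_upto h t : (branch_count t 1 <= h)%N -> t \in trees_upto h.
Proof.
elim: h t => [|h IH] [|l r]; rewrite ?inE //.
  by move=> hlt; have := branch_count_leaf_gt0 (Node l r); lia.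
rewrite branch_count_node1 => hlt; apply/orP; right.
have := branch_count_leaf_gt0 l; have := branch_count_leaf_gt0 r => hl hr.
by apply: allpairs_f; apply: IH; lia.
Qed.

Lemma trees_upto_uniq h : uniq (trees_upto h).
Proof.
elim: h => //= h IH; apply/andP; split.
  by apply/negP => /allpairsP [[l r] [_ _]].
by apply: allpairs_uniq => // -[l r] [l' r'] _ _ [-> ->].
Qed.

Variables (R : realType) (p : R).
Hypothesis p01 : 0 < p < 1.
Let q : R := (1 - p) / 2.

Let q_gt0 : 0 < q.
Proof. by rewrite /q; case/andP: p01 => *; lra. Qed.

(* Up to a factor depending only on the order, this is the law of the branching
   process in which every edge of the pruned tree ends with probability [p] and
   otherwise grows a leaf on its left or right, with probability [q] each. *)
Fixpoint tree_weight (t : bintree) : R :=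
  match t with
  | Leaf => q
  | Node l r => tree_weight l * tree_weight r *
                (if top_order l == top_order r then p ^+ 2 / q else 1)
  end.

Lemma tree_weight_gt0 t : 0 < tree_weight t.
Proof.
elim: t => [|l hl r hr] //=; rewrite !mulr_gt0 //; case: ifP => // _.
by rewrite divr_gt0 // exprn_gt0 //; case/andP: p01.
Qed.

Let Z h k := \sum_(t <- trees_upto h | top_order t == k) tree_weight t.
Let S h k := \sum_(t <- trees_upto h | (top_order t < k)%N) tree_weight t.

Let ZE h k : Z h k = \sum_(t <- trees_upto h) (top_order t == k)%:R * tree_weight t.
Proof.
by rewrite /Z big_mkcond; apply: eq_bigr => t _; case: eqP; rewrite ?mul1r ?mul0r.
Qed.

Let SE h k : S h k = \sum_(t <- trees_upto h) (top_order t < k)%N%:R * tree_weight t.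
Proof.
by rewrite /S big_mkcond; apply: eq_bigr => t _; case: ltnP; rewrite ?mul1r ?mul0r.
Qed.

Let S_rec h k : S h k.+1 = S h k + Z h k.
Proof.
rewrite ZE !SE -big_split /=; apply: eq_bigr => t _; rewrite -mulrDl -natrD.
by congr (_%:R * _); lia.
Qed.

Let Z_ge0 h k : 0 <= Z h k.
Proof. by apply: sumr_ge0 => t _; apply/ltW/tree_weight_gt0. Qed.

Let S_ge0 h k : 0 <= S h k.
Proof. by apply: sumr_ge0 => t _; apply/ltW/tree_weight_gt0. Qed.

(** The three terms are the exclusive ways to reach order [k.+2]: two children of order [k.+1], or
    exactly one child of order [k.+2], left or right, and the other of smaller order. *)
Let node_weight_split k l r :
  (top_order (Node l r) == k.+2)%:R * tree_weight (Node l r) =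
  p ^+ 2 / q * (((top_order l == k.+1)%:R * tree_weight l) *
                ((top_order r == k.+1)%:R * tree_weight r)) +
  ((top_order l == k.+2)%:R * tree_weight l) * ((top_order r < k.+2)%N%:R * tree_weight r) +
  ((top_order l < k.+2)%N%:R * tree_weight l) * ((top_order r == k.+2)%:R * tree_weight r).
Proof.
rewrite top_order_node [tree_weight (Node _ _)]/=.
move: (tree_weight l) (tree_weight r) => x y.
case: (altP (top_order l =P top_order r)) => [->|ne].
  rewrite maxnn addn1 eqSS.
  case: (altP (top_order r =P k.+1)) => [->|n1].
    by rewrite ltnSn (_ : (k.+1 == k.+2) = false) /=; [ring|lia].
  case: (altP (top_order r =P k.+2)) => [->|n2]; rewrite ?ltnn /=; ring.
rewrite addn0 mulr1.
have -> : (top_order l == k.+1)%:R * x * ((top_order r == k.+1)%:R * y) = 0.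
  case: (altP (top_order l =P k.+1)) => [e|]; last by rewrite !mul0r.
  by rewrite (_ : (top_order r == k.+1) = false) ?mul0r ?mulr0 //; lia.
rewrite mulr0 add0r.
have -> : (maxn (top_order l) (top_order r) == k.+2) =
  ((top_order l == k.+2) && (top_order r < k.+2)%N) ||
  ((top_order l < k.+2)%N && (top_order r == k.+2)) by lia.
case: (altP (top_order l =P k.+2)) => [->|n2]; rewrite ?ltnn /=.
  by rewrite orbF /=; ring.
by rewrite -mulnb natrM /=; ring.
Qed.

Let Z_succ1 h : Z h.+1 1 <= q.
Proof.
rewrite ZE big_cons /= mul1r gerDl big_allpairs_dep /=.
rewrite big1 // => l _; rewrite big1 // => r _; rewrite (_ : (_ == _) = false) ?mul0r //.
by have := top_order_gt0 l; have := top_order_gt0 r; lia.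
Qed.

Let Z_succ h k : Z h.+1 k.+2 =
  p ^+ 2 / q * Z h k.+1 ^+ 2 + 2 * (Z h k.+2 * S h k.+2).
Proof.
rewrite ZE big_cons mul0r add0r big_allpairs_dep /=.
under eq_bigr do under eq_bigr do rewrite node_weight_split.
under eq_bigr do rewrite !big_split /= -!mulr_sumr.
rewrite !big_split /= -!mulr_sumr -!mulr_suml.
by rewrite -!ZE -!SE; ring.
Qed.

(** Induction on the height. The values [p ^ k * q] are a fixed point of the recursion [Z_succ],
    because for the orders up to [j] they add up to [(1 - p ^ j) / 2]; the recursion is monotone as
    all weights are positive. *)
Lemma tree_weight_sum_le h k :
  \sum_(t <- trees_upto h | top_order t == k.+1) tree_weight t <= p ^+ k * q.
Proof.
have [p0 p1] := andP p01; rewrite -/(Z h k.+1).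
elim: h k => [|h IH] k; first by rewrite /Z big_nil mulr_ge0 ?exprn_ge0 // ltW.
case: k => [|k]; first by rewrite expr0 mul1r.
have Sle j : S h j.+1 <= (1 - p ^+ j) / 2.
  elim: j => [|j IHj].
    by rewrite expr0 subrr mul0r /S big_pred0 // => t; have := top_order_gt0 t; lia.
  rewrite S_rec; apply: le_trans (lerD IHj (IH j)) _.
  by rewrite exprS /q le_eqVlt; apply/orP; left; apply/eqP; field.
rewrite Z_succ.
have -> : p ^+ k.+1 * q = p ^+ 2 / q * (p ^+ k * q) ^+ 2
    + 2 * (p ^+ k.+1 * q * ((1 - p ^+ k.+1) / 2)).
  by rewrite exprS; field; rewrite gt_eqF.
apply: lerD.
  apply: ler_wpM2l; first by rewrite divr_ge0 ?exprn_ge0 // ltW.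
  by apply: lerXn2r; rewrite ?nnegrE // mulr_ge0 ?exprn_ge0 // ltW.
by apply: ler_wpM2l => //; apply: ler_pM.
Qed.

(** Each meeting of two children of order [i] gives one factor [p ^+ 2 / q] and starts one branch of
    order [i.+1]. *)
Lemma tree_weightE K t : (top_order t <= K.+1)%N ->
  tree_weight t = q ^+ branch_count t 1 *
    \prod_(1 <= i < K.+1) (p ^+ 2 / q) ^+ branch_count t i.+1.
Proof.
elim: t => [|l IHl r IHr].
  by rewrite big_nat_cond big1 ?mulr1 // => i; case: i.
rewrite top_order_node => hK; rewrite branch_count_node1 /=.
rewrite IHl ?IHr; [|by lia|by lia].
under [X in _ = _ * X]eq_bigr do rewrite !exprD.
rewrite !big_split /= exprD.
have -> : \prod_(1 <= i < K.+1) (p ^+ 2 / q) ^+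
   ((top_order l == top_order r) && (i.+1 == (top_order l).+1)) =
   (if top_order l == top_order r then p ^+ 2 / q else 1).
  case: (altP (top_order l =P top_order r)) => [e|ne] /=; last by rewrite big1.
  have l0 := top_order_gt0 l.
  rewrite (bigD1_seq (top_order l)) ?iota_uniq //=; last by rewrite mem_index_iota; lia.
  rewrite eqxx expr1 big1 ?mulr1 // => i /negbTE.
  by rewrite eqSS => ->.
by rewrite mulrACA !mulrA.
Qed.

End WeightedTrees.

(** * Stirling bounds, binomial coefficients and limits *)

Section Asymptotics.
Variable R : realType.
Implicit Types (p x y z : R) (n m : nat).

Lemma ln_sub_le x y : 0 < x -> 0 < y -> ln x - ln y <= x / y - 1.
Proof.
move=> x0 y0; rewrite -ln_div ?posrE //.
have -> : x / y = 1 + (x / y - 1) by ring.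
apply: le_trans (le_ln1Dx _) _; last by lra.
by have : 0 < x / y by [exact: divr_gt0]; lra.
Qed.

Lemma ln_nat_ge0 n : 0 <= ln (n%:R : R).
Proof. by case: n => [|n]; [rewrite ln0|apply: ln_ge0; rewrite ler1n]. Qed.

Lemma le_ln_nat m n : (m <= n)%N -> ln (m%:R : R) <= ln n%:R.
Proof.
case: m => [|m] mn; first by rewrite ln0 // ln_nat_ge0.
by rewrite ler_ln ?posrE ?ltr0n ?ler_nat //; lia.
Qed.

Lemma ln_factS n : ln (n.+1`!%:R : R) = ln n.+1%:R + ln n`!%:R.
Proof. by rewrite factS natrM lnM // posrE ltr0n ?fact_gt0. Qed.

(** From [ln t <= t - 1] at [t = (x + 1) / x] and at its inverse; this drives the induction steps of
    both Stirling bounds. *)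
Lemma ln_succ_bounds x : 0 < x ->
  x * (ln (x + 1) - ln x) <= 1 <= (x + 1) * (ln (x + 1) - ln x).
Proof.
move=> x0; have x1 : 0 < x + 1 by lra.
have h1 := ln_sub_le (x + 1) x x1 x0; have h2 := ln_sub_le x (x + 1) x0 x1.
have e1 : x * ((x + 1) / x - 1) = 1 by field; rewrite gt_eqF.
have e2 : (x + 1) * (x / (x + 1) - 1) = - 1 by field; rewrite gt_eqF.
have := ler_wpM2l (ltW x0) h1; have := ler_wpM2l (ltW x1) h2.
by rewrite e1 e2 => g2 g1; apply/andP; split; lra.
Qed.

Lemma ln_fact_ge n : n%:R * ln n%:R - n%:R <= ln (n`!%:R : R).
Proof.
elim: n => [|n IH]; first by rewrite fact0 ln1 mul0r subr0.
rewrite ln_factS; case: n IH => [|n] IH; first by rewrite fact0 !ln1; lra.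
have [+ _] := andP (ln_succ_bounds _ (ltr0Sn R n)).
by move: IH; rewrite -[n.+2%:R]natr1; lra.
Qed.

Lemma ln_fact_le n :
  ln (n`!%:R : R) <= n%:R * ln n%:R - n%:R + ln n%:R + 1.
Proof.
elim: n => [|n IH]; first by rewrite fact0 ln1 ln0 //; lra.
rewrite ln_factS; case: n IH => [|n] IH; first by rewrite fact0 !ln1; lra.
have [_ +] := andP (ln_succ_bounds _ (ltr0Sn R n)).
by move: IH; rewrite -[n.+2%:R]natr1; lra.
Qed.

(* Up to the logarithmic term, Stirling's formula bounds [ln 'C(n, m)] below by
   [n] times the entropy of [m / n], and the relative entropy from [(p, 1 - p)] is
   at most the chi-square distance. *)
Lemma ln_bin_ge p n m : 0 < p < 1 -> (m <= n)%N ->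
  - (m%:R * ln p) - (n - m)%:R * ln (1 - p)
  - (m%:R - n%:R * p) ^+ 2 / (p * (1 - p)) - 2 * ln n%:R - 2
  <= ln ('C(n, m)%:R : R).
Proof.
move=> /andP[p0 p1] mn; have p1' : 0 < 1 - p by lra.
case: n mn => [|n].
  rewrite leqn0 => /eqP ->; rewrite bin0 ln1 (ln0 (lexx 0)) subnn.
  by rewrite !mul0r !subr0 expr2 !mul0r; lra.
move=> mn; set N := n.+1 in mn *; set k := (N - m)%N.
have N0 : 0 < N%:R :> R by rewrite ltr0n.
have N1 : 1 <= N%:R :> R by rewrite ler1n.
have kE : k%:R = N%:R - m%:R :> R by rewrite natrB.
have lnC : ln ('C(N, m)%:R : R) = ln N`!%:R - ln m`!%:R - ln k`!%:R.
  rewrite -(bin_fact mn) natrM natrM lnM ?lnM ?posrE ?mulr_gt0 ?ltr0n ?fact_gt0 ?bin_gt0 //.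
  by rewrite -/k; lra.
have kl (a : nat) (c : R) : 0 < c ->
    a%:R * (ln a%:R - ln N%:R - ln c) <= a%:R * (a%:R / (N%:R * c) - 1).
  move=> c0; case: a => [|a]; first by rewrite !mul0r.
  apply: ler_wpM2l => //; rewrite -addrA -opprD -lnM ?posrE //.
  by apply: ln_sub_le; rewrite ?mulr_gt0 // ltr0n.
have h1 := kl m p p0; have h2 := kl k (1 - p) p1'.
have f1 := ln_fact_ge N; have f2 := ln_fact_le m; have f3 := ln_fact_le k.
have g1 := le_ln_nat m N mn.
have g2 : ln (k%:R : R) <= ln N%:R by apply: le_ln_nat; rewrite leq_subr.
(* Since [m + k = N], the left side is the right side divided by [N], and [N >= 1]. *)
have chi : m%:R * (m%:R / (N%:R * p) - 1) + k%:R * (k%:R / (N%:R * (1 - p)) - 1)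
    <= (m%:R - N%:R * p) ^+ 2 / (p * (1 - p)).
  have -> : m%:R * (m%:R / (N%:R * p) - 1) + k%:R * (k%:R / (N%:R * (1 - p)) - 1)
      = (m%:R - N%:R * p) ^+ 2 / (p * (1 - p)) / N%:R.
    by rewrite kE; field; rewrite !gt_eqF.
  rewrite ler_pdivrMr // ler_peMr // divr_ge0 ?sqr_ge0 // ltW // mulr_gt0 //.
rewrite lnC; move: chi h1 h2 f1 f2 f3 g1 g2; rewrite kE.
move: (_ / _ - 1) (_ / _ - 1) (_ ^+ 2 / _) (ln _`!%:R) (ln m`!%:R) (ln _) => u v w *.
nra.
Qed.

Lemma natr_mul_exp_le y n : 0 <= y < 1 -> n.+1%:R * y ^+ n <= (1 - y)^-1.
Proof.
move=> /andP[y0 y1]; have y1' : 0 < 1 - y by lra.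
rewrite -[leRHS]mul1r ler_pdivlMr //.
have : n.+1%:R * y ^+ n <= \sum_(i < n.+1) y ^+ i.
  rewrite -[in leLHS](card_ord n.+1) mulr_natl -sumr_const; apply: ler_sum => i _.
  by apply: ler_wiXn2l; rewrite ?y0 ?(ltW y1) // -ltnS.
move/(ler_wpM2r (ltW y1')) => /le_trans; apply.
by rewrite mulrC -opprB mulNr -subrX1 opprB gerBl exprn_ge0.
Qed.

Lemma cvg_sqr_mul_exp z : 0 <= z < 1 ->
  (n.+1%:R ^+ 2 * z ^+ n @[n --> \oo] --> (0 : R)).
Proof.
(* Here [z = x ^ 4]: each of the two factors [n.+1] stays bounded when multiplied by [x ^ n], and
   the remaining [y ^ n] tends to 0. *)
move=> /andP[z0 z1]; pose y := Num.sqrt z; pose x := Num.sqrt y.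
have sq (u : R) : 0 <= u < 1 -> 0 <= Num.sqrt u < 1.
  by move=> /andP[u0 u1]; rewrite sqrtr_ge0 /= -sqrtr1 ltr_sqrt.
have yP : 0 <= y < 1 by apply: sq; rewrite z0.
have xP := sq _ yP; rewrite -/x in xP.
have [y0 y1] := andP yP; have [x0 x1] := andP xP.
have zE : z = x ^+ 2 * y by rewrite sqr_sqrtr // -expr2 sqr_sqrtr.
apply: (@squeeze_cvgr _ _ _ _ (fun=> 0) (fun n => (1 - x)^-1 ^+ 2 * y ^+ n)).
- near=> n; apply/andP; split; first by rewrite mulr_ge0 ?exprn_ge0.
  rewrite zE exprMn mulrA ler_wpM2r ?exprn_ge0 // exprAC -exprMn.
  by apply: lerXn2r; rewrite ?nnegrE ?mulr_ge0 ?exprn_ge0 ?invr_ge0 ?natr_mul_exp_le //; lra.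
- exact: cvg_cst.
- rewrite -[X in _ --> X](mulr0 ((1 - x)^-1 ^+ 2)).
  by apply: cvgMl_tmp; apply: cvg_expr; rewrite ger0_norm.
Unshelve. all: by end_near.
Qed.

Lemma cvg_dist_le (f e : nat -> R) (l : R) :
  (forall n, `|f n - l| <= e n) -> e n @[n --> \oo] --> (0 : R) ->
  f n @[n --> \oo] --> l.
Proof.
move=> fe e0; apply: (@squeeze_cvgr _ _ _ _ (fun n => l - e n) (fun n => l + e n)).
- by near=> n; have := fe n; rewrite ler_distl.
- by rewrite -[X in _ --> X]subr0; apply: cvgB => //; exact: cvg_cst.
- by rewrite -[X in _ --> X]addr0; apply: cvgD => //; exact: cvg_cst.
Unshelve. all: by end_near.
Qed.

(** Merges different lower and upper errors into one, [u] dominating both; the term [|F|] pays for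
    replacing [x - 1] by [x]. *)
Lemma affine_error_le (X F x v y u c1 c2 d : R) :
  0 <= c1 -> 0 <= c2 -> 0 <= d -> 1 <= u -> v <= u -> y <= u ->
  F * (x - 1) - c1 * v <= X <= F * (x - 1) + d + c2 * y ->
  `|X - F * x| <= (`|F| + c1 + d + c2) * u.
Proof.
move=> c10 c20 d0 u1 vu yu /andP[lo up]; have u0 : 0 <= u by lra.
have m1 := ler_wpM2l c10 vu; have m2 := ler_wpM2l c20 yu.
have m3 := ler_wpM2l d0 u1; have m4 := ler_wpM2l (normr_ge0 F) u1.
have m5 := mulr_ge0 c10 u0; have m6 := mulr_ge0 c20 u0; have m7 := mulr_ge0 d0 u0.
have f1 := ler_norm F; have f2 := ler_norm (- F); rewrite normrN in f2.
by rewrite ler_norml; apply/andP; split; lra.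
Qed.

Lemma sum_geometric x n : x != 1 -> \sum_(i < n) x ^+ i = (x ^+ n - 1) / (x - 1).
Proof. by move=> x1; rewrite subrX1 mulrC mulKf // subr_eq0. Qed.

End Asymptotics.

(** * The number of admissible trees and the entropy rate *)

Section HortonTrees.
Variables (R : realType) (r alpha : R).
Hypotheses (hr : 2 < r) (halpha : 1 < alpha < r).

Let p : R := 2 / r.
Let q : R := (1 - p) / 2.
(** Chosen so that [E / (r - 1)] is the limit of [ln (card_hs K) / r ^ K]. *)
Let E : R := - ((r - 2) * ln q) - 2 * ln p.

Let r_gt0 : 0 < r. Proof. by move: hr => ?; lra. Qed.

Let p01 : 0 < p < 1.
Proof. by rewrite /p divr_gt0 //= ltr_pdivrMr // mul1r. Qed.

Let q01 : 0 < q < 1.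
Proof. by rewrite /q; case/andP: p01 => *; apply/andP; split; lra. Qed.

Let lnp_lt0 : ln p < 0. Proof. exact: ln_lt0. Qed.
Let lnq_lt0 : ln q < 0. Proof. exact: ln_lt0. Qed.

(** Indexed by the distance to the top order, so [N 0] belongs to the single branch of top order. *)
Let N (j : nat) : nat := Num.trunc (r ^+ j).

Let N_itv j : (N j)%:R <= r ^+ j < (N j)%:R + 1.
Proof. by rewrite natr1; apply: truncn_itv; apply: exprn_ge0; exact: ltW. Qed.

Let N0 : N 0 = 1%N.
Proof. by apply: truncn_def; rewrite expr0 lexx ltr1n. Qed.

Let N_double j : ((N j).*2 <= N j.+1)%N.
Proof.
have [h _] := andP (N_itv j); rewrite truncn_ge_nat ?exprn_ge0 ?(ltW r_gt0) //.
rewrite -mul2n natrM exprS; apply: ler_pM => //; exact: ltW.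
Qed.

Lemma hs_trees_branch_count K t : hs_trees r alpha K t <->
  top_order t = K /\ forall k, (1 <= k <= K)%N ->
    r ^+ (K - k) - alpha ^+ (K - k) < (branch_count t k)%:R
      < r ^+ (K - k) + alpha ^+ (K - k).
Proof.
by rewrite /hs_trees /= tree_orderE; split=> -[-> h]; split=> // k /h;
  rewrite num_branchesE.
Qed.

Lemma hs_trees_upto K t : hs_trees r alpha K.+1 t ->
  t \in trees_upto (Num.trunc (r ^+ K + alpha ^+ K)).
Proof.
move=> /hs_trees_branch_count [_ /(_ 1%N isT)]; rewrite subSS subn0 => /andP[_ h].
apply: mem_trees_upto; rewrite truncn_ge_nat ?(ltW h) //.
by apply: ltW; apply: le_lt_trans h; exact: ler0n.
Qed.

Lemma hs_trees_finite K : finite_set (hs_trees r alpha K.+1).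
Proof.
apply: (@sub_finite_set _ _ [set` trees_upto (Num.trunc (r ^+ K + alpha ^+ K))]).
  by move=> t /hs_trees_upto.
exact: finite_seq.
Qed.

Lemma hs_trees_profile K t : horton_profile N K.+1 t -> hs_trees r alpha K.+1 t.
Proof.
move=> [tK h]; apply/hs_trees_branch_count; split=> // k hk; rewrite h //.
have /andP[a1 _] := halpha.
have := exprn_ege1 (K.+1 - k) (ltW a1).
by have /andP[] := N_itv (K.+1 - k) => *; apply/andP; split; lra.
Qed.

Let card_hs K : nat := #|` fset_set (hs_trees r alpha K.+1)|.

Lemma card_hs_ge K :
  (\prod_(j < K) ('C(N j.+1 - 2, (N j).*2 - 2) * 2 ^ (N j.+1 - (N j).*2)) <= card_hs K)%N.
Proof.
have [s [us ps <-]] := trees_of_profile N K N0 N_double.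
have -> : size s = #|` [fset x in s]%fset| by rewrite card_fseq undup_id.
apply: fsubset_leq_card; apply/fsubsetP => t; rewrite !inE => /ps /hs_trees_profile ht.
by rewrite in_fset_set ?inE //; exact: hs_trees_finite.
Qed.

Let factor_gt0 j : (0 < 'C(N j.+1 - 2, (N j).*2 - 2) * 2 ^ (N j.+1 - (N j).*2))%N.
Proof. by rewrite muln_gt0 bin_gt0 expn_gt0 leq_sub2r. Qed.

Lemma card_hs_gt0 K : (0 < card_hs K)%N.
Proof. by apply: leq_trans (card_hs_ge K); apply: prodn_gt0 => j. Qed.

(** The first summand is the chi-square error, [2] and [2 * ln r] are the Stirling remainder, and
    the terms in [ln p] and [ln q] come from rounding and the shift by 2. *)
Let C1 : R := 16 / (p * (1 - p)) + 2 - 4 * ln p - ln q + 2 * ln r.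

Let C1_ge0 : 0 <= C1.
Proof.
have [p0 p1] := andP p01.
have h1 : 0 <= 16 / (p * (1 - p)) by rewrite divr_ge0 // mulr_ge0 ?(ltW p0) //; lra.
have h2 : 0 <= ln r by apply: ln_ge0; move: hr; lra.
by rewrite /C1; move: lnp_lt0 lnq_lt0; lra.
Qed.

(** Uses [ln_bin_ge] at [p = 2 / r], the limiting ratio of [2 N j] to [N j.+1]. As [1 - p = 2 q],
    the power of 2 turns [ln (1 - p)] into [ln q]. *)
Lemma ln_factor_ge j : r ^+ j * E - C1 * j.+1%:R <=
  ln (('C(N j.+1 - 2, (N j).*2 - 2) * 2 ^ (N j.+1 - (N j).*2))%:R : R).
Proof.
have [p0 p1] := andP p01; have [q0 q1] := andP q01.
have N1 : (0 < N j)%N by rewrite truncn_gt0 exprn_ege1 //; move: hr; lra.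
have Nd := N_double j.
set a := (N j.+1 - 2)%N; set b := ((N j).*2 - 2)%N.
have ab : (b <= a)%N by rewrite leq_sub2r.
have abE : (N j.+1 - (N j).*2 = a - b)%N by rewrite /a /b; move: (N j) (N j.+1) N1 Nd => x y; lia.
have bE : b%:R = 2 * (N j)%:R - 2 :> R.
  by rewrite natrB; [rewrite -mul2n natrM|move: (N j) N1 => x; lia].
have aE : a%:R = (N j.+1)%:R - 2 :> R by rewrite natrB //; move: (N j) (N j.+1) N1 Nd => x y; lia.
rewrite abE natrM natrX lnM ?posrE ?exprn_gt0 ?ltr0n ?bin_gt0 // lnXn // -[_ *+ (a - b)]mulr_natl.
have h := ln_bin_ge R p a b p01 ab.
have lnq : ln (1 - p) = ln q + ln 2.
  by rewrite -lnM ?posrE //; congr ln; rewrite /q; field.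
have [n1 n2] := andP (N_itv j); have [n3 n4] := andP (N_itv j.+1).
have pr : r * p = 2 by rewrite /p mulrC divfK // gt_eqF.
(* Both [b] and [a * p] have main term [2 r ^ j]; rounding and the shifts by 2 separate them by at
   most 4. *)
have sq : (b%:R - a%:R * p) ^+ 2 <= 16.
  have prj : r ^+ j.+1 * p = 2 * r ^+ j by rewrite exprSr -mulrA pr mulrC.
  have u1 : (N j.+1)%:R * p <= 2 * r ^+ j by rewrite -prj; apply: ler_wpM2r => //; exact: ltW.
  have u2 : 2 * r ^+ j <= (N j.+1)%:R * p + p.
    by rewrite -prj -[X in _ + X]mul1r -mulrDl; apply: ler_wpM2r; exact: ltW.
  have : 0 <= (4 - (b%:R - a%:R * p)) * (4 + (b%:R - a%:R * p)).
    by apply: mulr_ge0; rewrite bE aE; lra.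
  by lra.
have chi : (b%:R - a%:R * p) ^+ 2 / (p * (1 - p)) <= 16 / (p * (1 - p)).
  by apply: ler_wpM2r => //; rewrite invr_ge0 mulr_ge0 ?(ltW p0) //; lra.
have lna : ln (a%:R : R) <= j.+1%:R * ln r.
  rewrite mulr_natl -lnXn //; case: (posnP a) => [->|apos].
    by rewrite ln0 // ln_ge0 // exprn_ege1 //; move: hr; lra.
  by rewrite ler_ln ?posrE ?exprn_gt0 ?ltr0n // aE; lra.
have v1 : - (b%:R * ln p) >= - (2 * r ^+ j * ln p) + 4 * ln p.
  have : 0 <= (2 * (N j)%:R - 2 - (2 * r ^+ j - 4)) * - ln p.
    by apply: mulr_ge0; [lra|rewrite oppr_ge0 ltW].
  by rewrite bE; lra.
have v2 : - ((a - b)%:R * ln q) >= - ((r ^+ j.+1 - 2 * r ^+ j) * ln q) + ln q.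
  have : 0 <= ((N j.+1)%:R - 2 - (2 * (N j)%:R - 2) - (r ^+ j.+1 - 1 - 2 * r ^+ j)) * - ln q.
    by apply: mulr_ge0; [move: (r ^+ j.+1) n4 => y n4; lra|rewrite oppr_ge0 ltW].
  by rewrite natrB // aE bE; lra.
have j1 : 1 <= j.+1%:R :> R by rewrite ler1n.
have D0 : 0 <= 16 / (p * (1 - p)) by rewrite divr_ge0 // mulr_ge0 ?(ltW p0) //; lra.
have w : (16 / (p * (1 - p)) + 2 - 4 * ln p - ln q) * 1
    <= (16 / (p * (1 - p)) + 2 - 4 * ln p - ln q) * j.+1%:R.
  by apply: ler_wpM2l => //; move: lnp_lt0 lnq_lt0; lra.
rewrite lnq in h; rewrite /E /C1; move: v2 h chi w; rewrite exprS.
move: (_ ^+ 2 / _) (16 / _) (ln p) (ln q) (ln 2) (ln r) (ln a%:R) v1 lna.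
move: (ln _) (a - b)%:R b%:R (r ^+ j) j.+1%:R => *; lra.
Qed.

Lemma ln_card_hs_ge K :
  E * ((r ^+ K - 1) / (r - 1)) - C1 * K.+1%:R ^+ 2 <= ln (card_hs K)%:R.
Proof.
have r1 : r != 1 by rewrite gt_eqF //; move: hr; lra.
have step : \sum_(j < K) (r ^+ j * E - C1 * j.+1%:R) <=
    ln ((\prod_(j < K) ('C(N j.+1 - 2, (N j).*2 - 2) * 2 ^ (N j.+1 - (N j).*2)))%N%:R : R).
  elim: K => [|K IH]; first by rewrite !big_ord0 ln1.
  rewrite !big_ord_recr /= natrM lnM ?posrE ?ltr0n ?prodn_gt0 //.
  by apply: lerD => //; exact: ln_factor_ge.
apply: le_trans (le_trans step (le_ln_nat R _ _ (card_hs_ge K))).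
rewrite big_split /= -mulr_suml sum_geometric // mulrC lerD2l sumrN -mulr_sumr.
rewrite lerN2; apply: ler_wpM2l => //.
apply: (@le_trans _ _ (\sum_(j < K) K.+1%:R)).
  by apply: ler_sum => j _; rewrite ler_nat ltnS ltnW.
by rewrite sumr_const card_ord -[leLHS]mulr_natl expr2 ler_wpM2r // ler_nat leqnSn.
Qed.

Let c : R := 2 * ln p - ln q.
Let C2 : R := `|ln q| + `|c|.

Lemma ln_tree_weight_ge K t : hs_trees r alpha K.+1 t ->
  - (E * ((r ^+ K - 1) / (r - 1))) + ln q - C2 * (K.+1%:R * alpha ^+ K)
  <= ln (tree_weight R p t).
Proof.
move=> /hs_trees_branch_count [oK h].
have [p0 p1] := andP p01; have [q0 q1] := andP q01; have [a1 ar] := andP halpha.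
have r1 : r - 1 != 0 by rewrite gt_eqF //; move: hr; lra.
have pq0 : 0 < p ^+ 2 / q by rewrite divr_gt0 // exprn_gt0.
have lnpq : ln (p ^+ 2 / q) = c.
  by rewrite ln_div ?posrE ?exprn_gt0 // lnXn // /c mulr_natl.
have lnw : ln (tree_weight R p t) = (branch_count t 1)%:R * ln q
    + \sum_(1 <= i < K.+1) (branch_count t i.+1)%:R * c.
  have -> : \sum_(1 <= i < K.+1) (branch_count t i.+1)%:R * c =
      ln (\prod_(1 <= i < K.+1) (p ^+ 2 / q) ^+ branch_count t i.+1).
    elim: (index_iota _ _) => [|i s IH]; first by rewrite !big_nil ln1.
    rewrite !big_cons IH lnM ?posrE ?exprn_gt0 //; last first.
      by rewrite prodr_gt0 // => k _; rewrite exprn_gt0.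
    by rewrite lnXn // lnpq mulr_natl.
  rewrite (tree_weightE R p p01 K); last by rewrite oK.
  rewrite -/q lnM ?posrE ?exprn_gt0 ?prodr_gt0 // => [|i _]; last by rewrite exprn_gt0.
  by rewrite lnXn // mulr_natl.
(* The absolute value is there because the sign of [c] depends on [r]. *)
have dev (x y z d : R) : y - z < x < y + z -> y * d - `|d| * z <= x * d.
  move=> /andP[x1 x2]; have : `|(x - y) * d| <= `|d| * z.
    by rewrite normrM mulrC ler_wpM2l // ler_norml; apply/andP; split; lra.
  by rewrite ler_norml => /andP[]; lra.
have b1 : r ^+ K * ln q - `|ln q| * alpha ^+ K <= (branch_count t 1)%:R * ln q.
  by apply: dev; have := h 1%N isT; rewrite subSS subn0.
have b2 : \sum_(1 <= i < K.+1) (r ^+ (K - i) * c - `|c| * alpha ^+ K)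
    <= \sum_(1 <= i < K.+1) (branch_count t i.+1)%:R * c.
  apply: ler_sum_nat => i /andP[_]; rewrite ltnS => iK.
  have := h i.+1; rewrite subSS !ltnS leq0n => /(_ iK) hi.
  apply: le_trans (dev _ _ _ c hi); rewrite lerD2l lerN2; apply: ler_wpM2l => //.
  by apply: ler_weXn2l; [exact: ltW|rewrite leq_subr].
have b3 : \sum_(1 <= i < K.+1) (r ^+ (K - i) * c - `|c| * alpha ^+ K) =
    (r ^+ K - 1) / (r - 1) * c - `|c| * (K%:R * alpha ^+ K).
  rewrite big_add1 /= big_mkord big_split /= -mulr_suml sumr_const card_ord.
  congr (_ * _ + _); last by rewrite -[LHS]mulr_natl; ring.
  rewrite -sum_geometric; last by rewrite -subr_eq0.
  rewrite [RHS](reindex_inj rev_ord_inj) /=.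
  by apply: eq_bigr => i _.
rewrite lnw; move: b1 b2; rewrite {}b3 => b1 b2.
(* This is [E = - (r - 1) ln q - c]; the leaf term [r ^ K * ln q] exceeds it by the separate [ln q]
   of the statement. *)
have Ee : E * ((r ^+ K - 1) / (r - 1)) = - (r ^+ K - 1) * ln q - (r ^+ K - 1) / (r - 1) * c.
  by rewrite /E /c; field.
have aK : 0 <= alpha ^+ K by rewrite exprn_ge0 //; lra.
have m1 : `|ln q| * alpha ^+ K <= `|ln q| * (K.+1%:R * alpha ^+ K).
  by apply: ler_wpM2l => //; rewrite ler_peMl // ler1n.
have m2 : `|c| * (K%:R * alpha ^+ K) <= `|c| * (K.+1%:R * alpha ^+ K).
  by apply: ler_wpM2l => //; apply: ler_wpM2r => //; rewrite ler_nat.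
by rewrite Ee /C2; lra.
Qed.

(** Each tree of the class weighs at least [expR (- D)], and together they weigh at most
    [p ^ K * q <= 1]. *)
Lemma ln_card_hs_le K : ln (card_hs K)%:R <=
  E * ((r ^+ K - 1) / (r - 1)) - ln q + C2 * (K.+1%:R * alpha ^+ K).
Proof.
have [p0 p1] := andP p01; have [q0 q1] := andP q01.
set B := fset_set (hs_trees r alpha K.+1).
set D := leRHS.
have inB t : t \in B -> hs_trees r alpha K.+1 t.
  by rewrite in_fset_set ?inE //; exact: hs_trees_finite.
set s := trees_upto (Num.trunc (r ^+ K + alpha ^+ K)).
have sumB : \sum_(t <- B) tree_weight R p t <= 1.
  have -> : \sum_(t <- B) tree_weight R p t = \sum_(t <- s | t \in B) tree_weight R p t.
    rewrite -[RHS]big_filter; apply: perm_big; apply: uniq_perm.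
    - exact: fset_uniq.
    - by rewrite filter_uniq // trees_upto_uniq.
    - move=> t; rewrite mem_filter andbC; case: (boolP (t \in B)); last by rewrite andbF.
      by move=> /inB /hs_trees_upto ->.
  apply: (@le_trans _ _ (p ^+ K * q)); last first.
    by rewrite mulr_ile1 ?exprn_ge0 ?exprn_ile1 // ltW.
  apply: le_trans (tree_weight_sum_le R p p01 (Num.trunc (r ^+ K + alpha ^+ K)) K).
  rewrite big_mkcond [leRHS]big_mkcond; apply: ler_sum => t _.
  case: ifP => [/inB /hs_trees_branch_count [-> _]|_]; first by rewrite eqxx.
  by case: ifP => // _; apply/ltW/tree_weight_gt0.
have : (card_hs K)%:R * expR (- D) <= 1.
  apply: le_trans sumB; rewrite /card_hs -/B mulr_natl -iter_addr_0.
  rewrite -[#|` B|](count_predT (enum_fset B)) -big_const_seq.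
  rewrite big_seq [leRHS]big_seq; apply: ler_sum => t /inB /ln_tree_weight_ge h.
  have w0 := tree_weight_gt0 R p p01 t.
  by rewrite -[leRHS]lnK ?posrE // ler_expR; apply: le_trans h; rewrite /D; lra.
rewrite expRN ler_pdivrMr ?expR_gt0 // mul1r => h.
by rewrite -[leRHS]expRK ler_ln ?posrE ?expR_gt0 // ltr0n card_hs_gt0.
Qed.

Let z01 : 0 <= alpha / r < 1.
Proof.
have [a1 ar] := andP halpha.
by rewrite divr_ge0 ?(ltW r_gt0) //=; [rewrite ltr_pdivrMr // mul1r|lra].
Qed.

Lemma ln_card_hs_cvg : ln (card_hs K)%:R / r ^+ K @[K --> \oo] --> E / (r - 1).
Proof.
have [a1 ar] := andP halpha.
have r1 : 0 < r - 1 by move: hr; lra.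
pose C3 := `|E / (r - 1)| + C1 - ln q + C2.
(* The lower error of order [K.+1 ^ 2] and the upper one of order [K.+1 * alpha ^ K] are both
   covered by [w K * r ^ K]. *)
pose w (K : nat) : R := K.+1%:R ^+ 2 * (alpha / r) ^+ K.
have w0 : C3 * w K @[K --> \oo] --> (0 : R).
  rewrite -[X in _ --> X](mulr0 C3); apply: cvgMl_tmp; exact: cvg_sqr_mul_exp.
have C2_ge0 : 0 <= C2 by rewrite addr_ge0.
have bnd K : `|ln (card_hs K)%:R / r ^+ K - E / (r - 1)| <= C3 * w K.
  have rK : 0 < r ^+ K by rewrite exprn_gt0.
  have aK : 1 <= alpha ^+ K by rewrite exprn_ege1 // ltW.
  have k1 : 1 <= K.+1%:R :> R by rewrite ler1n.
  have k2 : K.+1%:R <= K.+1%:R ^+ 2 :> R by rewrite expr2 ler_peMl //; lra.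
  have u1 : K.+1%:R ^+ 2 <= K.+1%:R ^+ 2 * alpha ^+ K by rewrite ler_peMr // exprn_ge0.
  have u2 : K.+1%:R * alpha ^+ K <= K.+1%:R ^+ 2 * alpha ^+ K.
    by rewrite ler_wpM2r //; lra.
  have wE : C3 * w K = C3 * (K.+1%:R ^+ 2 * alpha ^+ K) / r ^+ K.
    by rewrite /w expr_div_n; ring.
  have -> : ln (card_hs K)%:R / r ^+ K - E / (r - 1) =
      (ln (card_hs K)%:R - E / (r - 1) * r ^+ K) / r ^+ K.
    by field; rewrite !gt_eqF.
  rewrite normrM normfV (gtr0_norm rK) wE ler_pM2r ?invr_gt0 //.
  have lo := ln_card_hs_ge K; have up := ln_card_hs_le K.
  apply: (affine_error_le _ _ _ _ _ _ _ _ _ _ C1_ge0 C2_ge0 _ _ u1 u2).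
  - by rewrite oppr_ge0 ltW.
  - by apply: le_trans u1; exact: le_trans k2.
  - have -> : E / (r - 1) * (r ^+ K - 1) = E * ((r ^+ K - 1) / (r - 1)).
      by rewrite mulrAC mulrA.
    by rewrite lo.
exact: cvg_dist_le bnd w0.
Qed.

Lemma hs_leaves_cvg (T : nat -> bintree) :
  (forall K, hs_trees r alpha K.+1 (T K)) ->
  (branch_count (T K) 1)%:R / r ^+ K @[K --> \oo] --> (1 : R).
Proof.
move=> hT; apply: (cvg_dist_le _ _ (fun K => (alpha / r) ^+ K)); last first.
  by have [z0 z1] := andP z01; apply: cvg_expr; rewrite ger0_norm.
move=> K; have /hs_trees_branch_count [_ /(_ 1%N isT)] := hT K.
rewrite subSS subn0 => /andP[b1 b2]; have rK : 0 < r ^+ K by rewrite exprn_gt0.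
have -> : (branch_count (T K) 1)%:R / r ^+ K - 1 =
    ((branch_count (T K) 1)%:R - r ^+ K) / r ^+ K.
  by field; rewrite gt_eqF.
rewrite normrM normfV (gtr0_norm rK) expr_div_n ler_pM2r ?invr_gt0 //.
by rewrite ler_norml; apply/andP; split; lra.
Qed.

(** In [2 * ln 2] the factor 2 is the ratio of vertices to leaves and [ln 2] changes the base of the
    logarithm. *)
Lemma entropy_rateE :
  E / (r - 1) / (2 * ln 2) = 1 - (1 - binary_entropy (2 / r)) / (2 - 2 / r).
Proof.
have [p0 p1] := andP p01; have [q0 q1] := andP q01.
have ln2 : 0 < ln (2 : R) by apply: ln_gt0; rewrite ltr1n.
have lnq : ln (1 - p) = ln q + ln 2.
  by rewrite -lnM ?posrE //; congr ln; rewrite /q; field.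
rewrite /binary_entropy /log2 -/p lnq /E /p.
move: (ln (2 / r)) (ln q) (ln 2) ln2 => a b d d0; field.
by rewrite !gt_eqF //; move: hr; lra.
Qed.

Lemma hs_entropyE K : hs_entropy r alpha K.+1 = ln (card_hs K)%:R / ln 2.
Proof.
rewrite /hs_entropy shannon_entropy_uniform //.
by rewrite -cardfs_gt0; exact: card_hs_gt0.
Qed.

Lemma hs_trees_nonempty K : hs_trees r alpha K.+1 !=set0.
Proof.
have := card_hs_gt0 K; rewrite cardfs_gt0 => /fset0Pn [t].
by rewrite in_fset_set ?inE; [exists t|exact: hs_trees_finite].
Qed.

Lemma hs_entropy_rate_cvg (T : nat -> bintree) :
  (forall K, hs_trees r alpha K.+1 (T K)) ->
  hs_entropy r alpha K.+1 / (num_vertices (T K))%:R @[K --> \oo]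
    --> 1 - (1 - binary_entropy (2 / r)) / (2 - 2 / r).
Proof.
move=> hT; rewrite -entropy_rateE.
have -> : E / (r - 1) / (2 * ln 2) = E / (r - 1) * 1^-1 / (2 * ln 2) by rewrite invr1 mulr1.
have -> : (fun K => hs_entropy r alpha K.+1 / (num_vertices (T K))%:R) =
    (fun K => ln (card_hs K)%:R / r ^+ K * ((branch_count (T K) 1)%:R / r ^+ K)^-1
              / (2 * ln 2)).
  apply/funext => K; rewrite hs_entropyE num_verticesE -mul2n natrM.
  have rK : r ^+ K != 0 by rewrite gt_eqF // exprn_gt0.
  have l0 : (branch_count (T K) 1)%:R != 0 :> R.
    by rewrite pnatr_eq0 -lt0n branch_count_leaf_gt0.
  have ln2 : ln (2 : R) != 0 by rewrite gt_eqF //; apply: ln_gt0; rewrite ltr1n.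
  by field; rewrite rK l0 ln2.
apply: cvgMr_tmp; apply: cvgM; first exact: ln_card_hs_cvg.
by apply: cvgV; [exact: oner_neq0|exact: hs_leaves_cvg].
Qed.

End HortonTrees.

(** Makes the number of vertices tend to infinity with the order, whichever trees are chosen. *)
Lemma top_order_le_leaves t : (top_order t <= branch_count t 1)%N.
Proof.
elim: t => // l hl r hr; rewrite top_order_node branch_count_node1.
by have := branch_count_leaf_gt0 l; have := branch_count_leaf_gt0 r; lia.
Qed.

Theorem theorem1 (R : realType) (r alpha : R) (hr : 2 < r)
    (halpha : 1 < alpha < r) :
  (forall K : nat, (1 <= K)%N ->
     finite_set (hs_trees r alpha K) /\ hs_trees r alpha K !=set0) /\
  (forall T : nat -> bintree,
     (forall K : nat, (1 <= K)%N -> hs_trees r alpha K (T K)) ->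
     (num_vertices (T K) @[K --> \oo] --> \oo) /\
     (hs_entropy r alpha K / (num_vertices (T K))%:R @[K --> \oo]
        --> 1 - (1 - binary_entropy (2 / r)) / (2 - 2 / r))).
Proof.
split=> [[//|K] _|T hT].
  by split; [exact: hs_trees_finite|exact: hs_trees_nonempty].
split.
  apply/cvgnyPge => A; near=> K.
  have K1 : (1 <= K)%N by near: K; exact: nbhs_infty_ge.
  have AK : (A <= K)%N by near: K; exact: nbhs_infty_ge.
  have [oK _] := (hs_trees_branch_count R r alpha K (T K)).1 (hT K K1).
  have := top_order_le_leaves (T K); rewrite num_verticesE oK; lia.
(* [T 0] is unconstrained, so the limit is taken along the orders [K.+1]. *)
rewrite -cvg_shiftS; apply: (hs_entropy_rate_cvg R r alpha hr halpha (fun K => T K.+1)).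
by move=> K; exact: hT.
Unshelve. all: by end_near.
Qed.
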